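(* Let $(P,\leq)$ be a finite supersolvable join-distributive lattice. Then $P$ is maximal.
   Context: A finite lattice is join-distributive if for every element $x$ and every set $Y$ of elements covering $x$ the interval $[x,\bigvee_{y\in Y}y]$ is boolean (isomorphic to the lattice of all subsets of a finite set). A finite lattice $P$ is supersolvable if it has a maximal chain $\mathfrak{m}$ such that for every maximal chain $\mathfrak{c}$ of $P$ the sublattice generated by $\mathfrak{m}\cup\mathfrak{c}$ is distributive. A finite join-distributive lattice is graded. A finite graded lattice $(P,\leq)$ with rank function $\mathrm{rk}:P\to\mathbb{Z}$ is called maximal if the addition of any finite collection of cover relations of the form $x\prec y$ with $\mathrm{rk}(y)=\mathrm{rk}(x)+1$ yields a nonlattice. Here the collection is nonempty and consists of new relations: pairs $(x,y)$ with $x\not\leq y$ in $P$; the resulting poset is the reflexive transitive closure of $\leq$ together with the added relations. *)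

(* Defs.v *)
From mathcomp Require Import all_boot all_order all_algebra.

Set Implicit Arguments.
Unset Strict Implicit.
Unset Printing Implicit Defensive.

Import Order.TTheory.
Local Open Scope order_scope.

Section Definitions.

Variables (d : Order.disp_t) (P : finTBLatticeType d).
Implicit Types (x y z u v w : P) (A C S Y : {set P}).

Definition covers x y := (x < y) && [forall z, ~~ (x < z < y)].

Definition boolean_interval x y :=
  exists (I : finType) (f : {set I} -> P),
    {mono f : B C / B \subset C >-> B <= C} /\
    f @: setT = [set u | x <= u <= y].

(* Y is nonempty because \join_(y in set0) y is \bot rather than x. For empty Y
   the join taken in the interval [x, \top] is x, and [x, x] is always boolean. *)
Definition join_distributive :=
  forall x Y, Y != set0 -> {in Y, forall y, covers x y} ->
  boolean_interval x (\join_(y in Y) y).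

Definition chain C := [forall u in C, forall v in C, u >=< v].

Definition maximal_chain C := maxset chain C.

Definition sublattice S :=
  [forall u in S, forall v in S, (u `&` v \in S) && (u `|` v \in S)].

Definition generated_sublattice A : {set P} :=
  \bigcap_(S : {set P} | sublattice S && (A \subset S)) S.

Definition distributive_sublattice S :=
  {in S & &, forall u v w, u `&` (v `|` w) = (u `&` v) `|` (u `&` w)}.

Definition supersolvable :=
  exists2 M, maximal_chain M &
    forall C, maximal_chain C ->
      distributive_sublattice (generated_sublattice (M :|: C)).

Definition rank_function (rk : P -> int) :=
  forall x y, covers x y -> rk y = (rk x + 1)%R.

Definition add_relations (R : {set P * P}) : rel P :=
  connect [rel x y | (x <= y) || ((x, y) \in R)].

Definition is_lattice (r : rel P) :=
  [/\ [/\ reflexive r, antisymmetric r & transitive r],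
      forall u v, exists w,
        [/\ r u w, r v w & forall z, r u z -> r v z -> r w z]
    & forall u v, exists w,
        [/\ r w u, r w v & forall z, r z u -> r z v -> r z w]].

(* In a finite lattice a rank function is unique up to an additive constant, so
   the choice of rk is immaterial. As it strictly increases along \le and along
   R, add_relations R is always a partial order (see add_relations_order), and
   each pair in R is a cover relation of it. *)
Definition maximal_lattice :=
  exists2 rk : P -> int, rank_function rk &
    forall R : {set P * P}, R != set0 ->
      {in R, forall p, ~~ (p.1 <= p.2) /\ rk p.2 = (rk p.1 + 1)%R} ->
      ~ is_lattice (add_relations R).

Lemma rank_function_lt rk x y : rank_function rk -> x < y -> (rk x < rk y)%R.
Proof.
move=> rkP; have [n le_n] := ubnP #|[set z | x < z < y]|.
elim: n => // n IHn in x y le_n *; move=> lt_xy.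
have [/forallP cov|] := boolP [forall z, ~~ (x < z < y)].
  have -> : rk y = (rk x + 1)%R.
    by apply: rkP; rewrite /covers lt_xy; apply/forallP.
  by rewrite Num.Theory.ltrDl.
rewrite negb_forall => /existsP[z]; rewrite negbK => /andP[lt_xz lt_zy].
have sub u v : x <= u -> v <= y -> (z == u) || (z == v) ->
    (#|[set w | (u < w < v)%O]| < n)%N.
  move=> le_xu le_vy eq_z; apply: leq_trans (_ : _ <= #|[set w | (x < w < y)%O]|)%N _.
    apply/proper_card/properP; split.
      apply/subsetP=> w; rewrite !inE => /andP[lt_uw lt_wv].
      by rewrite (le_lt_trans le_xu lt_uw) (lt_le_trans lt_wv le_vy).
    exists z; rewrite !inE ?lt_xz //.
    by case/orP: eq_z => /eqP->; rewrite ltxx ?andbF.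
  by rewrite -ltnS.
apply: (@lt_trans _ _ (rk z)); apply: IHn => //; apply: sub => //.
- exact: ltW.
- by rewrite eqxx orbT.
- exact: ltW.
- by rewrite eqxx.
Qed.

Lemma add_relations_order rk (R : {set P * P}) :
  rank_function rk -> {in R, forall p, rk p.2 = (rk p.1 + 1)%R} ->
  [/\ reflexive (add_relations R), antisymmetric (add_relations R)
    & transitive (add_relations R)].
Proof.
move=> rkP rkR.
have step x y : x != y -> add_relations R x y -> (rk x < rk y)%R.
  move=> neq_xy /connectP[p pth def_y]; rewrite {y}def_y in neq_xy *.
  elim: p x pth neq_xy => [|z p IHp] x /=; first by rewrite eqxx.
  move=> /andP[xz pth] neq; have [eq_xz|neq_xz] := eqVneq x z.
    by rewrite eq_xz in neq *; apply: IHp.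
  have lt_xz : (rk x < rk z)%R.
    case/orP: xz => [le_xz|/rkR /= ->]; last by rewrite Num.Theory.ltrDl.
    by apply: rank_function_lt => //; rewrite lt_neqAle neq_xz.
  have [<-//|neq_z] := eqVneq z (last z p).
  exact: lt_trans lt_xz (IHp _ pth neq_z).
split; [exact: connect0 | | exact: connect_trans].
move=> x y /andP[xy yx]; apply/eqP; apply: contraT => neq_xy.
have := lt_trans (step _ _ neq_xy xy) (step _ _ _ yx).
by rewrite ltxx eq_sym; apply.
Qed.

End Definitions.

Arguments join_distributive {d} P.
Arguments supersolvable {d} P.
Arguments maximal_lattice {d} P.

(* Main.v *)
(** Join-distributivity gives Birkhoff's condition: two distinct covers of x are
covered by their join. Hence P is graded and semimodular, and semimodularity
suffices. Given new relations forming a lattice order <=', pick (x, y) among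
them with x of least rank, and let v <= y cover x `&` y. By semimodularity
x `|` v covers x, and it differs from y. So x `|` v and y are distinct common
upper bounds of x and v whose rank exceeds that of x by one, which forces the
<='-join of x and v to be x itself. But v <=' x means v <= x, as no relation was
added below x: this contradicts the choice of v. *)

Require Import Defs.
From mathcomp Require Import all_boot all_order all_algebra.

Set Implicit Arguments.
Unset Strict Implicit.
Unset Printing Implicit Defensive.

Import Order.TTheory.
Local Open Scope order_scope.

Section Semimodularity.

Variables (d : Order.disp_t) (P : finTBLatticeType d).
Implicit Types (x y z u v w : P) (R : {set P * P}).

Lemma covers_lt x y : covers x y -> x < y.
Proof. by case/andP. Qed.

Lemma covers_between x y z : covers x y -> x <= z -> z <= y -> z = x \/ z = y.
Proof.
case/andP=> _ /forallP/(_ z); rewrite !lt_neqAle => + le_xz le_zy.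
rewrite le_xz le_zy !andbT negb_and !negbK => /orP[]/eqP->; first by left.
by right.
Qed.

Lemma exists_cover x y : x < y -> exists2 z, covers x z & z <= y.
Proof.
move=> lt_xy; pose between z := x < z <= y.
have by0 : between y by rewrite /between lt_xy lexx.
(* An element of the half-open interval above [x] up to [y] with the fewest elements below it is
   minimal there, hence covers [x]. *)
case: (arg_minnP (fun z => #|[set u | u <= z]|) by0) => z /andP[lt_xz le_zy] zmin.
exists z => //; rewrite /covers lt_xz; apply/forallP=> w.
apply/negP=> /andP[lt_xw lt_wz].
have /zmin : between w by rewrite /between lt_xw (le_trans (ltW lt_wz)).
apply/negP; rewrite -ltnNge; apply/proper_card/properP; split.
  by apply/subsetP=> u; rewrite !inE => /le_trans; apply; apply: ltW.
by exists z; rewrite !inE ?lexx // lt_geF.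
Qed.

Definition birkhoff_condition :=
  forall x y z, covers x y -> covers x z -> y != z -> covers y (y `|` z).

(** In the boolean interval from [x] to the join of [y] and [z], write the two covers as [f B] and
    [f C], and an element [w] strictly between [y] and the join as [f D]. Intersecting [D] with the
    atom [C] then forces [w] to be one of the two ends. *)
Lemma join_distributive_birkhoff : join_distributive P -> birkhoff_condition.
Proof.
move=> jdP x y z cov_xy cov_xz neq_yz.
have [||I [f [f_mono f_im]]] := jdP x [set y; z].
- by apply/set0Pn; exists y; rewrite set21.
- by move=> _ /set2P[]->.
rewrite big_setU1 ?inE // big_set1 in f_im.
have f_in B : x <= f B <= y `|` z.
  by have := imset_f f (in_setT B); rewrite f_im inE.
have f_onto u : x <= u -> u <= y `|` z -> exists B, u = f B.
  move=> le_xu le_u; have : u \in f @: setT by rewrite f_im inE le_xu.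
  by case/imsetP=> B _ ->; exists B.
have lt_xy := covers_lt cov_xy; have lt_xz := covers_lt cov_xz.
have [B defy] := f_onto _ (ltW lt_xy) (leUl y z).
have [C defz] := f_onto _ (ltW lt_xz) (leUr z y).
have nle_zy : ~~ (z <= y).
  apply/negP=> le_zy.
  have [eq_zx|eq_zy] := covers_between cov_xy (ltW lt_xz) le_zy.
    by rewrite eq_zx ltxx in lt_xz.
  by rewrite eq_zy eqxx in neq_yz.
rewrite /covers lt_neqAle leUl andbT; apply/andP; split.
  by apply: contraNneq nle_zy => ->; apply: leUr.
apply/forallP=> w; apply/negP=> /andP[lt_yw lt_w].
have [D defw] := f_onto _ (le_trans (ltW lt_xy) (ltW lt_yw)) (ltW lt_w).
have le_DC : f (D :&: C) <= z by rewrite defz f_mono subsetIr.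
have /andP[le_xDC _] := f_in (D :&: C).
(* If [D :&: C] gives [x], it is empty; as [B :|: C] is everything, [D] lies in [B]. If it gives
   [z], then [w] is above both [y] and [z]. *)
have [DC_x|DC_z] := covers_between cov_xz le_xDC le_DC.
  have BC_T : setT \subset B :|: C.
    rewrite -f_mono; have /andP[_ /le_trans->//] := f_in setT.
    by rewrite leUx defy defz !f_mono subsetUl subsetUr.
  have DC0 : D :&: C \subset set0.
    by rewrite -f_mono DC_x; have /andP[] := f_in set0.
  have : w <= y.
    rewrite defw defy f_mono; apply/subsetP=> i Di.
    have /setUP[//|Ci] := subsetP BC_T i (in_setT i).
    by have := subsetP DC0 i; rewrite !inE Di Ci => /(_ isT).
  by rewrite (lt_geF lt_yw).
have : y `|` z <= w.
  by rewrite leUx (ltW lt_yw) -DC_z defw f_mono subsetIl.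
by rewrite (lt_geF lt_w).
Qed.

(** Climb from [x] to [y] one cover at a time: for a cover [t <= y] of [x], the pair [x], [v]
    becomes [t], [t] joined with [v], and the join with [y] does not change. *)
Lemma birkhoff_semimodular x y v : birkhoff_condition ->
  x <= y -> covers x v -> ~~ (v <= y) -> covers y (y `|` v).
Proof.
move=> bP; have [n] := ubnP #|[set z | x < z]|.
elim: n => // n IHn in x v * => le_n le_xy cov_xv nle_vy.
have lt_xv := covers_lt cov_xv.
have [<-|neq_xy] := eqVneq x y; first by rewrite join_r // ltW.
have [|t cov_xt le_ty] := @exists_cover x y; first by rewrite lt_neqAle neq_xy.
have lt_xt := covers_lt cov_xt.
rewrite -[y in y `|` v](join_l le_ty) -joinA; apply: (IHn t) => //.
- rewrite -ltnS; apply: leq_trans le_n; rewrite ltnS.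
  apply/proper_card/properP; split; last by exists t; rewrite !inE ?ltxx.
  by apply/subsetP=> u; rewrite !inE; apply: lt_trans.
- by apply: (bP x) => //; apply: contraNneq nle_vy => <-.
- by rewrite leUx le_ty.
Qed.

(** The rank is built from the top down, by recursion on the number of elements strictly above. Any
    two covers of [x] have equal rank, since their join covers both. *)
Lemma birkhoff_graded :
  birkhoff_condition -> exists rk : P -> int, rank_function rk.
Proof.
move=> bP; pose up x := #|[set z | x < z]|.
have up_lt x y : x < y -> (up y < up x)%N.
  move=> lt_xy; apply/proper_card/properP; split.
    by apply/subsetP=> u; rewrite !inE; apply: lt_trans.
  by exists y; rewrite !inE ?ltxx.
suff /(_ #|P|.+1)[rk rkP] : forall n, exists rk : P -> int, forall x y,
    (up x < n)%N -> covers x y -> rk y = (rk x + 1)%R.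
  by exists rk => x y; apply: rkP; rewrite ltnS max_card.
elim=> [|n [rk rkP]]; first by exists (fun _ => 0%R).
(* The value at a new [x] is read off an arbitrary cover; the default 0 is reached only at the top,
   which has none. *)
exists (fun x => if (up x < n)%N then rk x
                 else if [pick y | covers x y] is Some y then (rk y - 1)%R
                 else 0%R) => x y lt_xn cov_xy.
have up_cover z : covers x z -> (up z < n)%N.
  by move=> /covers_lt/up_lt lt_zx; apply: leq_trans lt_zx _.
rewrite (up_cover y) //; have [lt_x|_] := ifP; first exact: rkP.
case: pickP => [z cov_xz|/(_ y)]; last by rewrite cov_xy.
rewrite GRing.subrK; have [<-//|neq_yz] := eqVneq y z.
have cov_y := bP _ _ _ cov_xy cov_xz neq_yz.
have cov_z : covers z (y `|` z) by rewrite joinC (bP x) // eq_sym.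
apply: (@GRing.addIr _ 1%R).
by rewrite -(rkP _ _ (up_cover y cov_xy) cov_y) -(rkP _ _ (up_cover z cov_xz) cov_z).
Qed.

Lemma add_relations_le R x y : x <= y -> add_relations R x y.
Proof. by move=> le_xy; apply: connect1; rewrite /= le_xy. Qed.

Lemma add_relations_in R x y : (x, y) \in R -> add_relations R x y.
Proof. by move=> Rxy; apply: connect1; rewrite /= Rxy orbT. Qed.

Lemma rank_function_le rk x y : rank_function rk -> x <= y -> (rk x <= rk y)%R.
Proof.
move=> rkP; rewrite le_eqVlt => /predU1P[->//|].
by move/(rank_function_lt rkP)/ltW.
Qed.

Lemma add_relations_rank_le rk R x y : rank_function rk ->
  {in R, forall p, rk p.2 = (rk p.1 + 1)%R} ->
  add_relations R x y -> (rk x <= rk y)%R.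
Proof.
move=> rkP rkR /connectP[p + ->]; elim: p x => //= z p IHp x /andP[xz pth].
apply: le_trans (IHp _ pth); case/orP: xz => [|/rkR/= ->].
  exact: (rank_function_le rkP).
by rewrite Num.Theory.lerDl.
Qed.

(** Ranks never drop along a path, so equal ranks at its ends exclude strict steps and pairs of
    [R]. *)
Lemma add_relations_rank_inj rk R x y : rank_function rk ->
  {in R, forall p, rk p.2 = (rk p.1 + 1)%R} ->
  add_relations R x y -> rk x = rk y -> x = y.
Proof.
move=> rkP rkR /connectP[p + ->]; elim: p x => //= z p IHp x /andP[xz pth] eq_rk.
have le_z : (rk z <= rk (last z p))%R.
  by apply: (add_relations_rank_le rkP rkR); apply/connectP; exists p.
case/orP: xz => [|/rkR/= rk_z]; last first.
  by move: le_z; rewrite -eq_rk rk_z Num.Theory.gerDl.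
rewrite le_eqVlt => /predU1P[eq_xz|/(rank_function_lt rkP)].
  by rewrite eq_xz in eq_rk *; apply: IHp.
by rewrite eq_rk ltNge le_z.
Qed.

(** A path through a pair of [R] would reach a rank above that of [y] and could not come back
    down. *)
Lemma add_relations_below rk R x y : rank_function rk ->
  {in R, forall p, rk p.2 = (rk p.1 + 1)%R} ->
  {in R, forall p, (rk y <= rk p.1)%R} -> add_relations R x y -> x <= y.
Proof.
move=> rkP rkR minR /connectP[p + def_y]; elim: p x def_y => /= [|z p IHp] x.
  by move=> ->.
move=> def_y /andP[xz pth]; case/orP: xz => [/le_trans|Rxz]; first by apply; apply: IHp.
have /(add_relations_rank_le rkP rkR) : add_relations R z y.
  by apply/connectP; exists p.
by rewrite (rkR _ Rxz) /= leNgt ltzD1 (minR _ Rxz).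
Qed.

Lemma birkhoff_maximal : birkhoff_condition -> maximal_lattice P.
Proof.
move=> bP; have [rk rkP] := birkhoff_graded bP.
exists rk => // R /set0Pn[p0 Rp0] Rnew [_ has_join _].
have rkR : {in R, forall p, rk p.2 = (rk p.1 + 1)%R} by move=> p /Rnew[].
case: (arg_minP (fun p => rk p.1) Rp0) => -[x y] Rxy /= minR.
have [/= nle_xy rk_y] := Rnew _ Rxy.
have nle_yx : ~~ (y <= x).
  apply/negP=> /(rank_function_le rkP).
  by rewrite rk_y Num.Theory.gerDl.
have [|v cov_v le_vy] := @exists_cover (x `&` y) y.
  by rewrite lt_neqAle leIr andbT; apply: contraNneq nle_yx => <-; apply: leIl.
have nle_vx : ~~ (v <= x).
  by apply/negP=> le_vx; have := lt_geF (covers_lt cov_v); rewrite lexI le_vx le_vy.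
have rk_xv := rkP _ _ (birkhoff_semimodular bP (leIl x y) cov_v nle_vx).
have [w [xw vw w_least]] := has_join x v.
have w_xv : add_relations R w (x `|` v).
  by apply: w_least; apply: add_relations_le; rewrite ?leUl ?leUr.
have w_y : add_relations R w y.
  by apply: w_least; [exact: add_relations_in | exact: add_relations_le].
(* At this rank [w] would equal both [x] joined with [v] and [y], giving [x <= y]. *)
have neq_w : rk w != (rk x + 1)%R.
  apply: contraNneq nle_xy => rk_w.
  have eq_xv : w = x `|` v.
    by apply: (add_relations_rank_inj rkP rkR w_xv); rewrite rk_w rk_xv.
  have <- : w = y by apply: (add_relations_rank_inj rkP rkR w_y); rewrite rk_w rk_y.
  by rewrite eq_xv leUl.
(* The rank of [w] lies between [rk x] and [rk y], which is [rk x + 1]; ranks being integers, only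
   [rk x] is left. *)
have eq_xw : x = w.
  apply: (add_relations_rank_inj rkP rkR xw); apply: le_anti.
  rewrite (add_relations_rank_le rkP rkR xw) /= -ltzD1 lt_neqAle neq_w -rk_y.
  exact: (add_relations_rank_le rkP rkR w_y).
rewrite -eq_xw in vw; move/negP: nle_vx; apply.
exact: (add_relations_below rkP rkR _ vw).
Qed.

End Semimodularity.

Theorem theorem4p9 (d : Order.disp_t) (P : finTBLatticeType d) :
  supersolvable P -> join_distributive P -> maximal_lattice P.
Proof. by move=> _ /join_distributive_birkhoff/birkhoff_maximal. Qed.
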